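(* Let $X$ be a $\mathrm{CAT}(0)$ space and let $\mathcal T_{\Delta}$ be the weak topology on $X$. For a topology $\mathcal T$ on $X$ the following two conditions are equivalent: (i) A bounded net $(x_{\alpha})$ in $X$ converges to a point $x\in X$ weakly if and only if $(x_{\alpha})$ converges to $x$ with respect to $\mathcal T$ (for all bounded nets $(x_\alpha)$ and all points $x\in X$). (ii) For every closed ball $B$ in $X$, the restriction of $\mathcal T$ to $B$ is Hausdorff and coincides with the restriction of $\mathcal T_{\Delta}$ to $B$.
   Context: All $\mathrm{CAT}(0)$ spaces are by definition complete and geodesic. A bounded net (in particular, a bounded sequence) $(x_\alpha)$ in a $\mathrm{CAT}(0)$ space $X$ converges weakly to a point $x\in X$ if for any compact geodesic $c$ in $X$ starting at $x$, the closest-point projections $\mathrm{Proj}_c(x_\alpha)$ of $x_\alpha$ to $c$ converge to $x$. The weak topology $\mathcal T_{\Delta}$ on $X$ is the topology whose closed sets are exactly those subsets $A\subset X$ such that whenever a bounded sequence of points of $A$ converges weakly to a point $x\in X$, one has $x\in A$. (It is the unique sequential topology on $X$ for which a sequence converges to $x$ if and only if it is bounded and converges weakly to $x$.) *)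

(* Defs.v *)
From HB Require Import structures.
From mathcomp Require Import all_boot all_order all_algebra.
From mathcomp Require Import all_classical all_reals all_analysis.

Set Implicit Arguments.
Unset Strict Implicit.
Unset Printing Implicit Defensive.

Import Order.TTheory GRing.Theory Num.Theory.
Import numFieldNormedType.Exports.

Local Open Scope classical_set_scope.
Local Open Scope ring_scope.

(* A topology as data on a fixed carrier: a metricType already carries its
   metric topology, so a second topology has to be passed explicitly. *)
Record topology (X : Type) := Topology {
  opens :> set (set X);
  opens_setT : opens setT;
  opens_setI : setI_closed opens;
  opens_bigcup : forall (I : Type) (f : I -> set X),
    (forall i, opens (f i)) -> opens (\bigcup_i f i)
}.

Definition topologized (X : choiceType) (T : topology X) : Type := X.

HB.instance Definition _ (X : choiceType) (T : topology X) :=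
  Choice.on (topologized T).
HB.instance Definition _ (X : choiceType) (T : topology X) :=
  isOpenTopological.Build (topologized T)
    (@opens_setT X T) (@opens_setI X T) (@opens_bigcup X T).

(* The subset B with the topology induced by T (not by the topology that X may
   already have). *)
Definition restriction (X : choiceType) (T : topology X) (B : set X)
  : topologicalType := set_type (B : set (topologized T)).

Definition restriction_opens (X : choiceType) (T : topology X) (B : set X)
  : set (set B) := @open (restriction T B).
Arguments restriction_opens {X} T B _.

Record net (X : Type) := Net {
  net_index : Type;
  net_le : net_index -> net_index -> Prop;
  net_term :> net_index -> X;
  net_inhabited : inhabited net_index;
  net_le_refl : forall i, net_le i i;
  net_le_trans : forall i j k, net_le i j -> net_le j k -> net_le i k;
  net_directed : forall i j, exists2 k, net_le i k & net_le j k
}.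

Definition tails (X : Type) (x : net X) : set_system (net_index x) :=
  filter_from setT (fun i => [set j | net_le i j]).
Arguments tails {X} x.

Definition net_cvg (X : choiceType) (T : topology X) (x : net X) (p : X) : Prop :=
  (x : net_index x -> topologized T) @ tails x --> (p : topologized T).

Section metric.
Context {R : realType} {X : metricType R}.
Implicit Types (p q r x y : X) (L : R) (c : R -> X).

Definition geodesic L c : Prop :=
  0 <= L /\ {in `[0, L] &, forall s t, mdist (c s) (c t) = `|s - t|}.

Definition geodesic_from_to p q L c : Prop :=
  [/\ geodesic L c, c 0 = p & c L = q].

(* R * R carries the sup norm in the library, hence the explicit distance. *)
Definition plane_dist (u v : R * R) : R :=
  Num.sqrt ((u.1 - v.1) ^+ 2 + (u.2 - v.2) ^+ 2).

Definition comparison_triangle p q r (p' q' r' : R * R) : Prop :=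
  [/\ plane_dist p' q' = mdist p q,
      plane_dist p' r' = mdist p r &
      plane_dist q' r' = mdist q r].

(* For x on a geodesic from p to q, the two equations say that x' is the point
   of the segment [p', q'] at distance mdist p x from p'. *)
Definition comparison_point p q (p' q' : R * R) x (x' : R * R) : Prop :=
  plane_dist p' x' = mdist p x /\ plane_dist x' q' = mdist x q.

(* Any two sides of a triangle share a vertex, so it suffices to compare points
   on the sides [p, q] and [p, r] for all choices of p, q and r. *)
Definition CAT0_inequality : Prop :=
  forall p q r L1 c1 L2 c2 (p' q' r' : R * R),
    geodesic_from_to p q L1 c1 -> geodesic_from_to p r L2 c2 ->
    comparison_triangle p q r p' q' r' ->
    forall (s t : R) (x' y' : R * R), s \in `[0, L1] -> t \in `[0, L2] ->
      comparison_point p q p' q' (c1 s) x' ->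
      comparison_point p r p' r' (c2 t) y' ->
      mdist (c1 s) (c2 t) <= plane_dist x' y'.

Definition closest_points (C : set X) y : set X :=
  [set z | C z /\ forall w, C w -> mdist y z <= mdist y w].

(* The closest point, when it is unique; in a CAT(0) space this is the case for
   C a compact geodesic. *)
Definition Proj (C : set X) y : X := xget y (closest_points C y).

Definition bounded_family (I : Type) (x : I -> X) : Prop :=
  exists (q : X) (r : R), forall i, mdist q (x i) <= r.

(* Weak convergence of x along F; F is the filter of tails for a net and \oo
   for a sequence. *)
Definition weakly_cvg (I : Type) (F : set_system I) (x : I -> X) p : Prop :=
  forall L c, geodesic L c -> c 0 = p ->
    (fun i => Proj (c @` `[0, L]) (x i)) @ F --> p.

Definition weakly_closed (A : set X) : Prop :=
  forall (u : nat -> X) p, (forall n, A (u n)) -> bounded_family u ->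
    weakly_cvg \oo u p -> A p.

Definition weakly_open : set (set X) := [set U | weakly_closed (~` U)].

Lemma weakly_open_setT : weakly_open setT.
Proof. by move=> u p uA; have := uA 0%N; rewrite setCT. Qed.

Lemma weakly_cvg_subseq (u : nat -> X) p (phi : nat -> nat) :
  phi @ \oo --> \oo -> weakly_cvg \oo u p -> weakly_cvg \oo (u \o phi) p.
Proof.
move=> phioo up L c gc cp.
exact: (cvg_comp phi (fun i => Proj (c @` `[0, L]) (u i)) phioo (up L c gc cp)).
Qed.

Lemma weakly_open_setI : setI_closed weakly_open.
Proof.
move=> U V oU oV u p; rewrite setCI => uUV [q [r uqr]] up.
have key (A : set X) (phi : nat -> nat) : weakly_closed A ->
    phi @ \oo --> \oo -> (forall n, A (u (phi n))) -> A p.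
  move=> cA phioo Aphi; apply: (cA (u \o phi)) => //.
    by exists q, r => n /=.
  exact: weakly_cvg_subseq.
have [freq|/existsNP[N HN]] :=
    pselect (forall N, exists n, (N <= n)%N /\ (~` U) (u n)).
  have [phi Hphi] := choice freq.
  left; apply: (key _ phi oU) => [|n]; last exact: (Hphi n).2.
  move=> S [m _ mS]; exists m => // n /= mn.
  by apply: mS; exact: leq_trans mn (Hphi n).1.
right; apply: (key _ (fun n => n + N)%N oV) => [|n]; first exact: cvg_addnr.
have [uU|//] := uUV (n + N)%N.
by exfalso; apply: HN; exists (n + N)%N; split => //; exact: leq_addl.
Qed.

Lemma weakly_open_bigcup (I : Type) (f : I -> set X) :
  (forall i, weakly_open (f i)) -> weakly_open (\bigcup_i f i).
Proof.
move=> of_ u p uf bu up [i _ fip].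
by apply: (of_ i u p) => // n fin; apply: (uf n); exists i.
Qed.

End metric.

Definition CAT0 (R : realType) (X : metricType R) : Prop :=
  [/\ (forall F : set_system X, ProperFilter F -> cauchy F -> exists p : X, F --> p),
      (forall p q : X, exists L c, geodesic_from_to p q L c) &
      @CAT0_inequality R X].

Definition cball (R : realType) (X : metricType R) (q : X) (r : R) : set X :=
  [set y | mdist q y <= r].

Definition weak_topology (R : realType) (X : metricType R) : topology X :=
  Topology (@weakly_open_setT R X) (@weakly_open_setI R X)
    (@weakly_open_bigcup R X).

(* Main.v *)
Require Import Defs.
From mathcomp Require Import all_boot all_order all_algebra.
From mathcomp Require Import all_classical all_reals all_analysis.
From mathcomp Require Import ring lra.

Set Implicit Arguments.
Unset Strict Implicit.
Unset Printing Implicit Defensive.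

Import Order.TTheory GRing.Theory Num.Theory.
Import numFieldNormedType.Exports.

Local Open Scope classical_set_scope.
Local Open Scope ring_scope.

(* By the CAT(0) inequality the squared distance to a point is strongly convex
   along midpoints, and a function with this property grows quadratically away
   from its minimizer, which exists on closed midpoint-closed sets because X is
   complete.  Weak convergence x -> p of a bounded family along a filter then
   becomes: for all z and e > 0, eventually
   d(p, x_i)^2 + d(p, z)^2 <= d(z, x_i)^2 + e.
   It follows that a weak limit of a net in a bounded set A is also the weak limit
   of a sequence in A, so weak convergence of nets implies convergence in the weak
   topology, and that every bounded ultrafilter has a weak limit, its asymptotic
   centre.  If the weak topology is Hausdorff on balls, a net converging in it to
   p has no finer ultrafilter with a weak limit other than p, so it converges
   weakly to p. *)

(** * Comparison triangles, midpoints and strong convexity *)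

Section midpoints.
Context {R : realType} {X : metricType R}.
Context (HX : CAT0 X).
Local Notation d := (@mdist R X).
Implicit Types (p q x y z : X) (K : set X) (g : X -> R).

(** Turns an error [h] in a distance into an error linear in [h] in its square, for distances
    bounded by [M]. *)
Lemma sqr_le_perturb (a b h M : R) : 0 <= a -> 0 <= b -> 0 <= h ->
  a <= M -> a <= b + h -> a ^+ 2 <= b ^+ 2 + 2 * M * h.
Proof.
move=> a0 b0 h0 aM ab; have [ab'|ba] := leP a b.
  have : a ^+ 2 <= b ^+ 2 by rewrite lerXn2r.
  have : 0 <= M * h by rewrite mulr_ge0// (le_trans a0).
  lra.
have : (a - b) * (a + b) <= h * (2 * M) by apply: ler_pM; lra.
lra.
Qed.

Lemma mdist_geodesic p q L c : geodesic_from_to p q L c -> d p q = L.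
Proof.
move=> [[L0 cL] <- <-]; rewrite cL ?in_itv/= ?lexx ?L0//.
by rewrite sub0r normrN ger0_norm.
Qed.

(** Stewart's theorem holds with equality in the comparison triangle. The factor [L] is kept so that
    a degenerate geodesic is covered. *)
Lemma geodesic_inequality p q z L c s : geodesic_from_to p q L c ->
  0 <= s <= L ->
  L * d (c s) z ^+ 2 <=
    (L - s) * d p z ^+ 2 + s * d q z ^+ 2 - s * (L - s) * L.
Proof.
move=> gc /andP[s0 sL]; have Lpq := mdist_geodesic gc.
have [[L0 cL] c0 cL'] := gc.
have [L00|Lneq0] := eqVneq L 0.
  have -> : s = 0 by apply/eqP; rewrite eq_le s0 andbT -L00.
  by rewrite L00; lra.
have Lgt0 : 0 < L by rewrite lt_neqAle eq_sym Lneq0.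
have [_ geo cat] := HX.
have [L2 [c2 g2]] := geo p z.
have L2pz := mdist_geodesic g2.
have [[L20 c2L] c20 c2L'] := g2.
set b := d p z; set a := d q z.
have a0 : 0 <= a by exact: mdist_ge0.
have b0 : 0 <= b by exact: mdist_ge0.
have tri1 : b <= L + a by rewrite -Lpq; exact: metric_triangle.
have tri2 : a <= L + b by rewrite -Lpq (metric_sym p q); exact: metric_triangle.
have tri3 : L <= a + b.
  by rewrite -Lpq addrC /a (metric_sym q); exact: metric_triangle.
(* With [p] placed at the origin and [q] at [(L, 0)], the law of cosines gives the first coordinate
   of [z]; the triangle inequalities give [u ^+ 2 <= b ^+ 2], so the second coordinate [v]
   exists. *)
pose u := (b ^+ 2 + L ^+ 2 - a ^+ 2) / (2 * L).
have uE : 2 * L * u = b ^+ 2 + L ^+ 2 - a ^+ 2.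
  by rewrite /u; field; rewrite gt_eqF.
have ub : u ^+ 2 <= b ^+ 2.
  have h : - (2 * L * b) <= 2 * L * u <= 2 * L * b.
    by rewrite uE; apply/andP; split; nra.
  have : - b <= u <= b by apply/andP; split; nra.
  by move=> /andP[? ?]; nra.
pose v := Num.sqrt (b ^+ 2 - u ^+ 2).
have vE : v ^+ 2 = b ^+ 2 - u ^+ 2 by rewrite sqr_sqrtr// subr_ge0.
have := cat p q z L c L2 c2 (0, 0) (L, 0) (u, v) gc g2.
have sqE (r e : R) : 0 <= r -> e = r ^+ 2 -> Num.sqrt e = r.
  by move=> r0 ->; rewrite sqrtr_sqr ger0_norm.
have cmp : comparison_triangle p q z (0, 0) (L, 0) (u, v).
  split; rewrite /plane_dist/=; apply: sqE; rewrite ?mdist_ge0//.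
  - by rewrite Lpq; ring.
  - by rewrite !sub0r !sqrrN vE -/b; ring.
  - by rewrite -/a sub0r sqrrN vE; nra.
move=> /(_ cmp s L2 (s, 0) (u, v)).
rewrite !in_itv/= s0 sL L20 lexx/=.
move=> /(_ erefl erefl).
have inL (r : R) : 0 <= r -> r <= L -> r \in `[0, L] by rewrite in_itv/= => -> ->.
have cp1 : comparison_point p q (0, 0) (L, 0) (c s) (s, 0).
  split; rewrite /plane_dist/=.
    rewrite -[in RHS]c0 cL ?inL// sub0r normrN ger0_norm//; apply: sqE => //.
    by ring.
  rewrite -[in RHS]cL' cL ?inL// -normrN opprB ger0_norm ?subr_ge0//.
  by apply: sqE; [rewrite subr_ge0|ring].
have cp2 : comparison_point p z (0, 0) (u, v) (c2 L2) (u, v).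
  rewrite c2L'; split; rewrite /plane_dist/=.
    apply: sqE; rewrite -/b//.
    by rewrite !sub0r !sqrrN vE; ring.
  by rewrite mdistxx !subrr expr0n/= addr0 sqrtr0.
move=> /(_ cp1 cp2); rewrite c2L' /plane_dist/= => h.
have : d (c s) z ^+ 2 <= (s - u) ^+ 2 + (0 - v) ^+ 2.
  rewrite -[leRHS]sqr_sqrtr ?addr_ge0 ?sqr_ge0//.
  by rewrite lerXn2r ?nnegrE ?mdist_ge0 ?sqrtr_ge0.
rewrite sub0r sqrrN vE => {}h.
have := ler_wpM2l L0 h; move/le_trans; apply.
rewrite le_eqVlt; apply/orP; left; apply/eqP.
have -> : a ^+ 2 = b ^+ 2 + L ^+ 2 - 2 * L * u by rewrite uE; ring.
by ring.
Qed.

Definition midpoint p q m := d p m = d p q / 2 /\ d q m = d p q / 2.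

(** The case [s = L / 2] of [geodesic_inequality]: the CN inequality of Bruhat and Tits. *)
Lemma midpoint_ex p q : exists m, midpoint p q m /\
  forall z, d m z ^+ 2 <= d p z ^+ 2 / 2 + d q z ^+ 2 / 2 - d p q ^+ 2 / 4.
Proof.
have [_ geo _] := HX; have [L [c gc]] := geo p q.
have Lpq := mdist_geodesic gc; have [[L0 cL] c0 cL'] := gc.
have hin : 0 <= L / 2 <= L by apply/andP; split; lra.
exists (c (L / 2)); rewrite Lpq; split.
  split.
    rewrite -{1}c0 cL ?in_itv/= ?lexx ?L0// sub0r normrN ger0_norm//; lra.
  rewrite -{1}cL' cL ?in_itv/= ?lexx ?L0// ger0_norm; lra.
move=> z; have := geodesic_inequality z gc hin.
have [L00 _|Lneq0] := eqVneq L 0.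
  have pq : p = q by apply: mdist_positivity; rewrite Lpq.
  by rewrite L00 mul0r c0 -pq; lra.
have Lgt0 : 0 < L by rewrite lt_neqAle eq_sym Lneq0.
by move=> h; rewrite -(ler_pM2l Lgt0); apply: le_trans h _; lra.
Qed.

Definition mid p q := xget p (midpoint p q).

(** For the [m] of [midpoint_ex], the inequality at [z = mid p q] has right-hand side 0, so [m] is
    [mid p q]. *)
Lemma mid_inequality p q z :
  d (mid p q) z ^+ 2 <= d p z ^+ 2 / 2 + d q z ^+ 2 / 2 - d p q ^+ 2 / 4.
Proof.
have [m [mm hm]] := midpoint_ex p q.
have [h1 h2] : midpoint p q (mid p q) by apply: (xgetPex p); exists m.
suff -> : mid p q = m by [].
apply: mdist_positivity; have := hm (mid p q); rewrite h1 h2 metric_sym => h.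
have := mdist_ge0 (mid p q) m; nra.
Qed.

Lemma mid_midpoint p q : midpoint p q (mid p q).
Proof. by have [m [mm _]] := midpoint_ex p q; apply: (xgetPex p); exists m. Qed.

Lemma midpoint_unique p q m : midpoint p q m -> mid p q = m.
Proof.
move=> [h1 h2]; apply: mdist_positivity.
by have := mid_inequality p q m; have := mdist_ge0 (mid p q) m; rewrite h1 h2; nra.
Qed.

Definition midpoint_closed K := forall p q, K p -> K q -> K (mid p q).

Definition strongly_convex K g := forall p q, K p -> K q ->
  g (mid p q) ^+ 2 <= g p ^+ 2 / 2 + g q ^+ 2 / 2 - d p q ^+ 2 / 4.

Lemma mdist_strongly_convex K z : strongly_convex K (d z).
Proof. by move=> p q _ _; rewrite !(metric_sym z); exact: mid_inequality. Qed.

(* The constant lambda in g z ^+ 2 >= g m ^+ 2 + lambda * d m z ^+ 2 improves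
   to (1 + lambda) / 2 when the inequality is applied to mid m z. *)
Lemma minimizer_inequality K g m z : midpoint_closed K ->
  (forall x, K x -> 0 <= g x) -> strongly_convex K g ->
  K m -> (forall x, K x -> g m <= g x) -> K z ->
  g m ^+ 2 + d m z ^+ 2 <= g z ^+ 2.
Proof.
move=> Kmid g0 gconv Km min Kz.
have iter (n : nat) y : K y -> g m ^+ 2 + (1 - 2^-1 ^+ n) * d m y ^+ 2 <= g y ^+ 2.
  elim: n y => [|n IH] y Ky.
    rewrite expr0 subrr mul0r addr0 lerXn2r ?nnegrE ?g0//; exact: min.
  have h := IH _ (Kmid _ _ Km Ky).
  have [hm _] := mid_midpoint m y.
  have := gconv _ _ Km Ky; move: h; rewrite hm (exprS _ n).
  by set e := 2^-1 ^+ n; nra.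
rewrite leNgt; apply/negP => lt.
have D0 : 0 < d m z ^+ 2.
  have := iter 0%N z Kz; rewrite expr0 subrr mul0r addr0 => h.
  have := sqr_ge0 (d m z); nra.
(* The relative defect of the claim; [iter] bounds it by [2^-1 ^+ n] for every [n]. *)
pose e := (g m ^+ 2 + d m z ^+ 2 - g z ^+ 2) / d m z ^+ 2.
have e0 : 0 < e by rewrite divr_gt0// subr_gt0.
have [n] : exists n : nat, (2^-1 : R) ^+ n < e.
  have cv : (fun n => (2^-1 : R) ^+ n) @ \oo --> (0 : R).
    by apply: cvg_expr; rewrite ger0_norm ?invf_lt1 ?ltr1n.
  have/cvgrPdist_lt/(_ e e0)[N _ HN] := cv.
  exists N; have := HN N (leqnn N).
  by rewrite /= sub0r normrN ger0_norm// exprn_ge0.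
have := iter n z Kz; set t := _ ^+ n => h te.
have : t * d m z ^+ 2 < e * d m z ^+ 2 by rewrite ltr_pM2r.
rewrite /e divfK ?gt_eqF//; lra.
Qed.

End midpoints.

(** * Minimizers of strongly convex functions and projections to geodesics *)

Section projections.
Context {R : realType} {X : metricType R}.
Context (HX : CAT0 X).
Local Notation d := (@mdist R X).
Implicit Types (p q x y z : X) (K : set X) (g : X -> R).

(** Near-minimizers form a Cauchy filter: if two of them were far apart, [g] at their midpoint would
    be below the infimum. *)
Lemma minimizer_ex K g : K !=set0 -> closed K -> midpoint_closed K ->
  (forall x, 0 <= g x) -> (forall x y, g x <= g y + d x y) ->
  strongly_convex K g ->
  exists2 m, K m & forall x, K x -> g m <= g x.
Proof.
move=> [x0 Kx0] Kcl Kmid g0 glip gconv.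
pose I := inf (g @` K).
have hinf : has_inf (g @` K).
  by split; [exists (g x0), x0|exists 0 => _ [x _ <-]].
have I0 : 0 <= I.
  by apply: lb_le_inf; [exists (g x0), x0|move=> _ [x _ <-]].
have IK x : K x -> I <= g x.
  by move=> Kx; apply: ge_inf; [case: hinf|exists x].
pose S (e : R) := K `&` [set x | g x < I + e].
pose F := filter_from [set e : R | 0 < e] S.
have FP : ProperFilter F.
  apply: filter_from_proper.
    apply: filter_from_filter; first by exists 1; rewrite /= ltr01.
    move=> e1 e2 /= e10 e20; exists (Num.min e1 e2).
      by rewrite /= lt_min e10.
    move=> x [Kx]; rewrite /= -ltrBlDl lt_min => /andP[h1 h2].
    by split; split => //=; rewrite -ltrBlDl.
  move=> e /= e0; have [_ [x Kx <-] h] := inf_adherent e0 hinf.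
  by exists x.
have Fcauchy : cauchy F.
  apply: cauchy_exP => eps eps0.
  (* Strong convexity gives [d a b ^+ 2 <= 4 * ((I + e) ^+ 2 - I ^+ 2)], which is at most
     [e * (8 * I + 4)] when [e <= 1]. *)
  pose e := Num.min 1 (eps ^+ 2 / (8 * I + 8)).
  have e0 : 0 < e by rewrite lt_min ltr01 divr_gt0 ?exprn_gt0//; lra.
  have e1 : e <= 1 by rewrite ge_min lexx.
  have e2 : e * (8 * I + 8) <= eps ^+ 2.
    by rewrite -ler_pdivlMr ?ge_min ?lexx ?orbT//; lra.
  have [_ [a Ka <-] ha] := inf_adherent e0 hinf.
  exists a; exists e => // b [Kb /= hb].
  rewrite ballEmdist/= ltNge; apply/negP => h.
  have h1 := gconv _ _ Ka Kb.
  have h2 := IK _ (Kmid _ _ Ka Kb).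
  have h3 := IK _ Ka; have h4 := IK _ Kb.
  have k1 : I ^+ 2 <= g (mid a b) ^+ 2 by rewrite lerXn2r ?nnegrE.
  have Ie0 : 0 <= I + e by rewrite addr_ge0// ltW.
  have k2 : g a ^+ 2 <= (I + e) ^+ 2.
    by rewrite lerXn2r ?nnegrE ?g0// ltW.
  have k3 : g b ^+ 2 <= (I + e) ^+ 2.
    by rewrite lerXn2r ?nnegrE ?g0// ltW.
  have k4 : eps ^+ 2 <= d a b ^+ 2 by rewrite lerXn2r ?nnegrE ?mdist_ge0 ?(ltW eps0).
  have k5 : e ^+ 2 <= e by rewrite expr2 ler_piMr// ltW.
  have k6 : I * e >= 0 by rewrite mulr_ge0// ltW.
  nra.
have [complete _ _] := HX.
have [m Fm] := complete F FP Fcauchy.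
exists m.
  apply: (@closed_cvg _ _ F FP id K Kcl _ m Fm).
  by exists 1 => [|x []] //=.
suff mI : g m <= I by move=> x Kx; exact: le_trans mI (IK _ Kx).
apply/ler_addgt0Pr => e e0.
have e20 : 0 < e / 2 by rewrite divr_gt0.
have h1 : F (ball m (e / 2)) by apply: Fm; exact: nbhsx_ballx.
have h2 : F (S (e / 2)) by exists (e / 2).
have [x [/= bx [_ /= gx]]] := filter_ex (filterI h1 h2).
rewrite ballEmdist/= in bx.
have := glip m x; lra.
Qed.

Lemma continuous_mdist_geodesic L (c : R -> X) y : geodesic L c ->
  {within `[0, L], continuous (fun s => d y (c s))}.
Proof.
move=> [L0 cL]; apply/subspace_continuousP => s sL.
apply/cvgrPdist_lt => e e0.
have : \forall t \near s, `|s - t| < e by exact: (@nbhsx_ballx _ R s e e0).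
rewrite near_withinE; apply: filterS => t ts tL.
have ct := cL _ _ sL tL.
have h1 := metric_triangle y (c t) (c s).
have h2 := metric_triangle y (c s) (c t).
rewrite (metric_sym (c t)) ct in h1; rewrite ct in h2.
by apply: le_lt_trans ts; rewrite /from_subspace ler_norml; apply/andP; split; lra.
Qed.

Lemma geodesic_midpoint_closed L (c : R -> X) :
  geodesic L c -> midpoint_closed (c @` `[0, L]).
Proof.
move=> [L0 cL] _ _ [s /= sL <-] [t /= tL <-].
have hm : (s + t) / 2 \in `[0, L].
  by move: sL tL; rewrite !in_itv/= => /andP[? ?] /andP[? ?]; apply/andP; split; lra.
exists ((s + t) / 2) => //; apply/esym/(midpoint_unique HX).
split; rewrite !cL//.
  by rewrite (_ : s - (s + t) / 2 = (s - t) / 2) ?normrM ?[`|2^-1|]gtr0_norm//; field.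
by rewrite (_ : t - (s + t) / 2 = (t - s) / 2) ?normrM ?[`|2^-1|]gtr0_norm ?(distrC t)//; field.
Qed.

(** The distance to [y] attains its minimum on the compact interval, so [xget] never returns its
    default in [Proj]. *)
Lemma Proj_closest_points L (c : R -> X) y :
  geodesic L c -> closest_points (c @` `[0, L]) y (Proj (c @` `[0, L]) y).
Proof.
move=> gc; have [s sL smin] := EVT_min gc.1 (continuous_mdist_geodesic (y := y) gc).
apply: (xgetPex y); exists (c s); split; first by exists s.
by move=> _ [t tL <-]; exact: smin.
Qed.

Lemma closest_points_inequality K y z w : midpoint_closed K ->
  closest_points K y z -> K w -> d y z ^+ 2 + d z w ^+ 2 <= d y w ^+ 2.
Proof.
move=> Kmid [Kz zmin] Kw.
apply: (minimizer_inequality HX Kmid) => // [x _|]; first exact: mdist_ge0.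
exact: mdist_strongly_convex.
Qed.

Lemma Proj_inequality L (c : R -> X) y s : geodesic L c -> s \in `[0, L] ->
  let z := Proj (c @` `[0, L]) y in
  d y z ^+ 2 + d z (c s) ^+ 2 <= d y (c s) ^+ 2.
Proof.
move=> gc sL /=; apply: (@closest_points_inequality (c @` `[0, L])).
- exact: geodesic_midpoint_closed.
- exact: Proj_closest_points.
- by exists s.
Qed.

(** * Weak convergence of bounded families in terms of distances *)

Section weak_convergence.
Context {I : Type} {F : set_system I} {FF : ProperFilter F}.
Context {x : I -> X} (bx : bounded_family x).

Lemma bounded_family_mdist p : exists M, forall i, d p (x i) <= M.
Proof.
have [q [r hr]] := bx; exists (d p q + r) => i.
by apply: le_trans (metric_triangle _ q _) _; rewrite lerD2l.
Qed.

(** On a geodesic from [p] to [z] the projection [P] of [x i] tends to [p]. Replacing [P] by [p] in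
    [Proj_inequality] changes two squares, by at most [2 * M * h] each. *)
Lemma weakly_cvg_near p z (e : R) : weakly_cvg F x p -> 0 < e ->
  \forall i \near F, d p (x i) ^+ 2 + d p z ^+ 2 <= d z (x i) ^+ 2 + e.
Proof.
move=> xp e0; have [_ geo _] := HX; have [L [c gc]] := geo p z.
have [gc' c0 cL] := gc; have [L0 _] := gc'.
have [M0 hM0] := bounded_family_mdist p.
pose M := Num.max M0 (d p z).
have hM i : d p (x i) <= M by rewrite le_max hM0.
have hz : d p z <= M by rewrite le_max lexx orbT.
have M0' : 0 <= M by apply: le_trans hz; exact: mdist_ge0.
pose h := e / (4 * M + 1).
have h0 : 0 < h by rewrite divr_gt0//; lra.
have hE : h * (4 * M + 1) = e by rewrite /h divfK// gt_eqF//; lra.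
have /metricType_numDomainType.cvgrPdist_lt/(_ h h0) := xp L c gc' c0.
apply: filterS => i; set P := Proj _ _ => hP.
have inL : L \in `[0, L] by rewrite in_itv/= L0 lexx.
have := Proj_inequality (x i) gc' inL; rewrite /= -/P cL.
rewrite (metric_sym (x i) P) (metric_sym (x i) z) => key.
have t1 := metric_triangle p P (x i); have t2 := metric_triangle p P z.
have := sqr_le_perturb (mdist_ge0 p (x i)) (mdist_ge0 P _) (ltW h0) (hM i).
have := sqr_le_perturb (mdist_ge0 p z) (mdist_ge0 P _) (ltW h0) hz.
move=> /(_ z ltac:(lra)) k1 /(_ (x i) ltac:(lra)) k2.
nra.
Qed.

(** If the projection [c s] had [s > e], then [c e] would lie between [p] and [c s]; as [c s] is no
    farther from [x i] than [p], convexity would make [c e] no farther than [p] either. *)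
Lemma weakly_cvg_of_lt p :
  (forall z, z != p -> \forall i \near F, d p (x i) < d z (x i)) ->
  weakly_cvg F x p.
Proof.
move=> hp L c gc c0; apply/metricType_numDomainType.cvgrPdist_le => e e0.
have [L0 cL] := gc.
have in0 : 0 \in `[0, L] by rewrite in_itv/= lexx L0.
have dp s : s \in `[0, L] -> d p (c s) = s.
  move=> sL; rewrite -c0 cL// sub0r normrN ger0_norm//.
  by move: sL; rewrite in_itv/= => /andP[].
have [Le|eL] := leP L e.
  apply: nearW => i; have [[s sL <-] _] := Proj_closest_points (x i) gc.
  by rewrite dp//; move: sL; rewrite /= in_itv/= => /andP[_]; lra.
have inE : e \in `[0, L] by rewrite in_itv/= !ltW.
have cep : c e != p by rewrite eq_sym -mdist_gt0 dp.
apply: filterS (hp _ cep) => i lt.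
have [[s sL sP] Pmin] := Proj_closest_points (x i) gc.
rewrite -sP dp// leNgt; apply/negP => es.
have gs : geodesic_from_to p (c s) s c.
  split => //; split; first by rewrite ltW// (lt_trans e0).
  move=> u v us vs; apply: cL; move: us vs sL; rewrite /= !in_itv/=.
    by move=> /andP[-> u_s] _ /andP[_ sL]; exact: le_trans sL.
  by move=> _ /andP[-> v_s] /andP[_ sL]; exact: le_trans sL.
have es' : 0 <= e <= s by rewrite !ltW.
have key := geodesic_inequality HX (x i) gs es'.
have h0 : d (c s) (x i) <= d p (x i).
  rewrite !(metric_sym _ (x i)) sP -c0; apply: Pmin; by exists 0.
have h1 : d p (x i) ^+ 2 < d (c e) (x i) ^+ 2.
  by rewrite ltrXn2r ?nnegrE ?mdist_ge0.
have h2 : d (c s) (x i) ^+ 2 <= d p (x i) ^+ 2.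
  by rewrite lerXn2r ?nnegrE ?mdist_ge0.
have s0 : 0 < s by exact: lt_trans es.
have k1 := ler_wpM2l (ltW e0) h2.
have k2 : s * d p (x i) ^+ 2 < s * d (c e) (x i) ^+ 2 by rewrite ltr_pM2l.
have k3 : 0 <= e * (s - e) * s by rewrite !mulr_ge0// ?subr_ge0 ltW.
clear sP c0; lra.
Qed.

(** Adding the two inequalities of [weakly_cvg_near] cancels the distances to [x i]. *)
Lemma weakly_cvg_unique p q : weakly_cvg F x p -> weakly_cvg F x q -> p = q.
Proof.
move=> xp xq; apply: mdist_positivity.
have D0 := mdist_ge0 p q; apply/eqP; rewrite eq_le D0 andbT leNgt; apply/negP => D.
have e0 : 0 < d p q ^+ 2 / 2 by rewrite divr_gt0// exprn_gt0.
have [i [h1 h2]] :=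
  filter_ex (filterI (weakly_cvg_near q xp e0) (weakly_cvg_near p xq e0)).
by move: h1 h2; rewrite /= (metric_sym q p) => ? ?; nra.
Qed.

Lemma weakly_cvg_cball q r p : weakly_cvg F x p ->
  (forall i, cball q r (x i)) -> cball q r p.
Proof.
move=> xp xr; rewrite /cball/=.
have r0 : 0 <= r.
  have [i _] := filter_ex (@filterT _ F _).
  exact: le_trans (mdist_ge0 _ _) (xr i).
rewrite -ler_sqr ?nnegrE ?mdist_ge0//; apply/ler_addgt0Pr => e e0.
have [i h] := filter_ex (weakly_cvg_near q xp e0).
have := xr i; rewrite /cball/= => h'.
have : d q (x i) ^+ 2 <= r ^+ 2 by rewrite lerXn2r ?nnegrE ?mdist_ge0.
have := sqr_ge0 (d p (x i)).
rewrite (metric_sym q p); lra.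
Qed.

End weak_convergence.
End projections.

(** * Closures of midpoint-closed sets and weak limits of sequences *)

Section weak_limits.
Context {R : realType} {X : metricType R}.
Context (HX : CAT0 X).
Local Notation d := (@mdist R X).
Implicit Types (p q x y z : X) (K : set X) (g : X -> R).

Lemma closure_mdistP K p :
  closure K p <-> forall e, 0 < e -> exists2 z, K z & d p z < e.
Proof.
split=> [Kp e e0|Kp B /nbhs_ballP[e /= e0 eB]].
  have [z [Kz]] := Kp _ (nbhsx_ballx p e e0).
  by rewrite ballEmdist; exists z.
have [z Kz pz] := Kp e e0; exists z; split => //.
by apply: eB; rewrite ballEmdist.
Qed.

(** [mid_inequality] is tested at [mid p' q'], whose distances to [p] and [q] are at most
    [d p q / 2 + 2 * h]. *)
Lemma mid_near p q p' q' (h : R) : d p p' <= h -> d q q' <= h ->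
  d (mid p q) (mid p' q') ^+ 2 <= 2 * d p q * h + 4 * h ^+ 2.
Proof.
move=> pp' qq'; have [m1 m2] := mid_midpoint HX p' q'.
have t1 := metric_triangle p p' (mid p' q').
have t2 := metric_triangle q q' (mid p' q').
have t3 := metric_triangle p' p q'.
have t4 := metric_triangle p q q'.
rewrite m1 in t1; rewrite m2 in t2; rewrite (metric_sym p' p) in t3.
have D0 := mdist_ge0 p q; have h0 := mdist_ge0 p p'.
have k (r : R) : 0 <= r -> r <= d p q / 2 + 2 * h ->
    r ^+ 2 <= (d p q / 2 + 2 * h) ^+ 2.
  by move=> r0 rh; rewrite lerXn2r ?nnegrE// (le_trans r0).
have := k _ (mdist_ge0 p (mid p' q')) ltac:(lra).
have := k _ (mdist_ge0 q (mid p' q')) ltac:(lra).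
have := mid_inequality HX p q (mid p' q').
lra.
Qed.

Lemma closure_midpoint_closed K : midpoint_closed K -> midpoint_closed (closure K).
Proof.
move=> Kmid p q /closure_mdistP Kp /closure_mdistP Kq.
apply/closure_mdistP => e e0; set D := d p q; have D0 : 0 <= D := mdist_ge0 p q.
pose h := Num.min 1 (e ^+ 2 / (2 * D + 5)).
have h0 : 0 < h by rewrite lt_min ltr01 divr_gt0 ?exprn_gt0//; lra.
have h1 : h <= 1 by rewrite ge_min lexx.
have h2 : h * (2 * D + 5) <= e ^+ 2.
  by rewrite -ler_pdivlMr ?ge_min ?lexx ?orbT//; lra.
have [p' Kp' pp'] := Kp h h0; have [q' Kq' qq'] := Kq h h0.
exists (mid p' q'); first exact: Kmid.
have := mid_near (ltW pp') (ltW qq'); rewrite -/D => key.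
have hh : h ^+ 2 <= h by rewrite expr2 ler_piMr// ltW.
rewrite ltNge; apply/negP => ge.
have : e ^+ 2 <= d (mid p q) (mid p' q') ^+ 2.
  by rewrite lerXn2r ?nnegrE ?mdist_ge0// ltW.
lra.
Qed.

Section sequence.
Context {I : Type} {F : set_system I} {FF : ProperFilter F}.
Context {x : I -> X} (bx : bounded_family x).

Lemma filter_all_seq (P : X -> set I) (s : seq X) :
  (forall z, F (P z)) -> F [set i | forall z, z \in s -> P z i].
Proof.
move=> FP; elim: s => [|a s IH]; first by apply: nearW => i z; rewrite in_nil.
apply: filterS (filterI (FP a) IH) => i [Pa Ps] z.
by rewrite inE => /orP[/eqP->//|]; exact: Ps.
Qed.

(* The sequence is chosen together with a countable midpoint-closed set Z
   containing p and all its terms, each term being almost perpendicular at p to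
   the finitely many points of Z already listed.  In the closure of Z this makes
   p the limit; the projection to this closure extends that to all of X. *)
Lemma weakly_cvg_sequence (A : set X) p :
  weakly_cvg F x p -> F (x @^-1` A) ->
  exists u : nat -> X,
    [/\ forall n, A (u n), bounded_family u & weakly_cvg \oo u p].
Proof.
move=> xp FA.
pose near_perp (e : R) i z := d p (x i) ^+ 2 + d p z ^+ 2 <= d z (x i) ^+ 2 + e.
have step (ns : nat * seq X) : exists i,
    A (x i) /\ forall z, z \in ns.2 -> near_perp ns.1.+1%:R^-1 i z.
  have n0 : 0 < ns.1.+1%:R^-1 :> R by rewrite invr_gt0 ltr0n.
  have FN : F [set i | forall z, z \in ns.2 -> near_perp ns.1.+1%:R^-1 i z].
    by apply: filter_all_seq => z; exact: weakly_cvg_near.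
  exact: filter_ex (filterI FA FN).
have [pick pickP] := choice step.
(* Each stage adds the new term and all midpoints of the previous list, so the union of the lists is
   midpoint-closed. *)
pose st := fix st n := if n is n'.+1 then
  st n' ++ x (pick (n', st n')) :: [seq mid a b | a <- st n', b <- st n']
  else [:: p].
pose u n := x (pick (n, st n)).
have stS n z : z \in st n -> z \in st n.+1 by move=> /= zn; rewrite mem_cat zn.
have st_le n m z : (n <= m)%N -> z \in st n -> z \in st m.
  elim: m => [|m IH]; first by rewrite leqn0 => /eqP->.
  by rewrite leq_eqVlt => /orP[/eqP->//|nm] /(IH nm)/stS.
pose Z := [set z | exists n, z \in st n].
have Zp : Z p by exists 0%N; rewrite /= inE.
have Zu n : Z (u n) by exists n.+1; rewrite /= mem_cat inE eqxx orbT.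
have Zmid : midpoint_closed Z.
  move=> a b [n an] [m bm]; exists (maxn n m).+1.
  rewrite /= mem_cat inE; apply/orP; right; apply/orP; right.
  apply/allpairsP; exists (a, b); split => //=.
    by apply: st_le an; exact: leq_maxl.
  by apply: st_le bm; exact: leq_maxr.
have bu : bounded_family u by have [q [r h]] := bx; exists q, r => n; exact: h.
have Zperp z : Z z -> forall e, 0 < e ->
    \forall n \near \oo, d p (u n) ^+ 2 + d p z ^+ 2 <= d z (u n) ^+ 2 + e.
  move=> [N zN] e e0; near=> n.
  have zn : z \in st n by apply: st_le zN; near: n; exact: nbhs_infty_ge.
  apply: le_trans ((pickP (n, st n)).2 z zn) _; rewrite lerD2l ltW//=.
  by near: n; exact: (near_infty_natSinv_lt (PosNum e0)).
pose K := closure Z.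
have Kperp z : K z -> forall e, 0 < e ->
    \forall n \near \oo, d p (u n) ^+ 2 + d p z ^+ 2 <= d z (u n) ^+ 2 + e.
  move=> /closure_mdistP Kz e e0.
  have [M1 hM1] := bounded_family_mdist bu z.
  (* The 1 allows for passing from [z] to a nearby [z'] in [Z]; this changes two squares, by at most
     [2 * M * h] each, within [e / 2] in total. *)
  pose M := Num.max (d p z) (M1 + 1).
  have M0 : 0 <= M by rewrite le_max mdist_ge0.
  pose h := Num.min 1 (e / (8 * M + 1)).
  have h0 : 0 < h by rewrite lt_min ltr01 divr_gt0//; lra.
  have h1 : h <= 1 by rewrite ge_min lexx.
  have h2 : h * (8 * M + 1) <= e.
    by rewrite -ler_pdivlMr ?ge_min ?lexx ?orbT//; lra.
  have [z' Zz' zz'] := Kz h h0.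
  have e20 : 0 < e / 2 by rewrite divr_gt0.
  apply: filterS (Zperp z' Zz' _ e20) => n key.
  have t1 := metric_triangle p z' z; have t2 := metric_triangle z' z (u n).
  rewrite (metric_sym z' z) in t1 t2.
  have zM : d p z <= M by rewrite le_max lexx.
  have uM : d z' (u n) <= M.
    by rewrite le_max; apply/orP; right; have := hM1 n; lra.
  have := sqr_le_perturb (mdist_ge0 p z) (mdist_ge0 p z') (ltW h0) zM ltac:(lra).
  have := sqr_le_perturb (mdist_ge0 z' (u n)) (mdist_ge0 z (u n)) (ltW h0) uM ltac:(lra).
  lra.
exists u; split => // [n|]; first exact: (pickP _).1.
apply: weakly_cvg_of_lt => // z zp.
have Kmid : midpoint_closed K by exact: closure_midpoint_closed.
have [m Km mmin] : exists2 m, K m & forall y, K y -> d z m <= d z y.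
  apply: (minimizer_ex HX) => //.
  - by exists p; exact: subset_closure.
  - exact: closed_closure.
  - by move=> y; exact: mdist_ge0.
  - by move=> a b; rewrite (metric_sym a b); exact: metric_triangle.
  - exact: mdist_strongly_convex.
(* With [m] the projection of [z] to [K], adding its projection inequality to [Kperp m] makes
   [d z (u n) ^+ 2] exceed [d p (u n) ^+ 2] by at least [e], which is positive because [z != p]. *)
pose e := (d z m ^+ 2 + d p m ^+ 2) / 2.
have e0 : 0 < e.
  rewrite divr_gt0//; have [->|mp] := eqVneq m p.
    by rewrite ltr_pwDl ?sqr_ge0// exprn_gt0// mdist_gt0.
  by rewrite ltr_wpDl ?sqr_ge0// exprn_gt0// mdist_gt0 eq_sym.
apply: filterS (Kperp m Km e e0) => n key.
have := closest_points_inequality HX Kmid (conj Km mmin) (subset_closure (Zu n)).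
rewrite ltNge => h; apply/negP => le.
have : d z (u n) ^+ 2 <= d p (u n) ^+ 2 by rewrite lerXn2r ?nnegrE ?mdist_ge0.
move: e0 key; rewrite /e; lra.
Unshelve. all: by end_near.
Qed.

Lemma weakly_closed_limit (A : set X) p : weakly_closed A ->
  weakly_cvg F x p -> F (x @^-1` A) -> A p.
Proof.
move=> cA xp FA; have [u [uA bu up]] := weakly_cvg_sequence xp FA.
exact: cA uA bu up.
Qed.

End sequence.

(** * Weak limits of bounded ultrafilters *)

Section ultrafilter.
Context {I : Type} {F : set_system I} {FU : UltraFilter F}.
Context {x : I -> X} (bx : bounded_family x).

(** The upper limit of [d z (x i)] along [F], as the infimum of the eventual upper bounds. *)
Let g z := inf [set r : R | \forall i \near F, d z (x i) <= r].

Let has_inf_g z : has_inf [set r : R | \forall i \near F, d z (x i) <= r].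
Proof.
split; first by have [M hM] := bounded_family_mdist bx z; exists M; exact: nearW.
exists 0 => r /filter_ex[i]; apply: le_trans; exact: mdist_ge0.
Qed.

Let g_le z r : (\forall i \near F, d z (x i) <= r) -> g z <= r.
Proof. by move=> h; apply: ge_inf => //; case: (has_inf_g z). Qed.

Let g_lt z r : g z < r -> \forall i \near F, d z (x i) <= r.
Proof.
move=> gr; have e0 : 0 < r - g z by rewrite subr_gt0.
have [t h] := inf_adherent e0 (has_inf_g z).
rewrite -/(g z) addrC subrK => /ltW tr.
by apply: filterS h => i /le_trans; exact.
Qed.

Let g_ge0 z : 0 <= g z.
Proof.
apply: lb_le_inf; first by case: (has_inf_g z).
by move=> r /filter_ex[i]; apply: le_trans; exact: mdist_ge0.
Qed.

Let g_lipschitz y z : g y <= g z + d y z.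
Proof.
apply/ler_addgt0Pr => e e0; apply: g_le.
have : g z < g z + e by rewrite ltrDl.
move=> /g_lt; apply: filterS => i h.
have := metric_triangle y z (x i); lra.
Qed.

(** The midpoint inequality at each [x i] passes to the upper limit; [h] is chosen so that
    [h * (g a + g b) + h ^+ 2 <= e]. *)
Let g_strongly_convex : strongly_convex setT g.
Proof.
move=> a b _ _; apply/ler_addgt0Pr => e e0.
have ga := g_ge0 a; have gb := g_ge0 b.
pose h := Num.min 1 (e / (g a + g b + 1)).
have h0 : 0 < h by rewrite lt_min ltr01 divr_gt0//; lra.
have h1 : h <= 1 by rewrite ge_min lexx.
have h2 : h * (g a + g b + 1) <= e.
  by rewrite -ler_pdivlMr ?ge_min ?lexx ?orbT//; lra.
have hh : h ^+ 2 <= h by rewrite expr2 ler_piMr// ltW.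
pose Q := (g a + h) ^+ 2 / 2 + (g b + h) ^+ 2 / 2 - d a b ^+ 2 / 4.
have FQ : \forall i \near F, d (mid a b) (x i) ^+ 2 <= Q.
  have : g a < g a + h by rewrite ltrDl.
  have : g b < g b + h by rewrite ltrDl.
  move=> /g_lt Fb /g_lt Fa; apply: filterS (filterI Fa Fb) => i [/= ha hb].
  have := mid_inequality HX a b (x i); rewrite /Q.
  have : d a (x i) ^+ 2 <= (g a + h) ^+ 2.
    by rewrite lerXn2r ?nnegrE ?mdist_ge0// addr_ge0// ltW.
  have : d b (x i) ^+ 2 <= (g b + h) ^+ 2.
    by rewrite lerXn2r ?nnegrE ?mdist_ge0// addr_ge0// ltW.
  lra.
have Q0 : 0 <= Q by have [i] := filter_ex FQ; apply: le_trans; exact: sqr_ge0.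
have : g (mid a b) <= Num.sqrt Q.
  apply: g_le; apply: filterS FQ => i hi.
  by rewrite -[leLHS]ger0_norm ?mdist_ge0// -sqrtr_sqr ler_sqrt.
move=> gQ.
have : g (mid a b) ^+ 2 <= Q.
  by rewrite -(sqr_sqrtr Q0) lerXn2r ?nnegrE ?sqrtr_ge0.
rewrite /Q; lra.
Qed.

(* The limit is the asymptotic centre: the minimizer of z |-> limsup_F d z x. *)
Lemma ultra_weakly_cvg : exists p, weakly_cvg F x p.
Proof.
have [q _] := bx.
have Tmid : midpoint_closed [set: X] by [].
have [m _ mmin] : exists2 m, [set: X] m & forall y, [set: X] y -> g m <= g y.
  apply: (minimizer_ex HX _ closedT Tmid g_ge0 g_lipschitz g_strongly_convex).
  by exists q.
exists m; apply: (weakly_cvg_of_lt HX) => z zm.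
have := minimizer_inequality HX Tmid (fun y _ => g_ge0 y) g_strongly_convex
  (Logic.I : [set: X] m) mmin (Logic.I : [set: X] z).
have D0 : 0 < d m z by rewrite mdist_gt0 eq_sym.
have g0m := g_ge0 m; have g0z := g_ge0 z => gmz.
have {gmz} mz : g m < g z by nra.
have Fm : \forall i \near F, d m (x i) <= (g m + g z) / 2 by apply: g_lt; lra.
(* For a general filter this would hold only frequently; the ultrafilter makes it eventual. *)
have Fz : \forall i \near F, ~ (d z (x i) <= (g m + g z) / 2).
  have [/g_le|//] := in_ultra_setVsetC [set i | d z (x i) <= (g m + g z) / 2] FU.
  lra.
apply: filterS (filterI Fm Fz) => i [/= h1 /negP].
by rewrite -ltNge; exact: le_lt_trans.
Qed.

End ultrafilter.
End weak_limits.

(** * Refining a filter to avoid a set that it does not contain *)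

Lemma within_setC_proper (I : Type) (F : set_system I) {FF : Filter F} (V : set I) :
  ~ F V -> ProperFilter (within (~` V) F).
Proof.
move=> FV; split; last exact: within_filter.
move=> h; apply: FV.
by apply: (@filterS _ F FF _ _ _ h) => i Vi; apply: contrapT => /Vi.
Qed.

Lemma sub_within (I : Type) (F : set_system I) {FF : Filter F} (V : set I) :
  F `<=` within V F.
Proof. by move=> A FA; apply: filterS FA => i. Qed.

Lemma within_self (I : Type) (F : set_system I) {FF : Filter F} (V : set I) :
  within V F V.
Proof. by apply: nearW. Qed.

Section weak_topology_convergence.
Context {R : realType} {X : metricType R}.

Lemma weakly_cvg_sub (I : Type) (F G : set_system I) (x : I -> X) p :
  F `<=` G -> weakly_cvg F x p -> weakly_cvg G x p.
Proof. by move=> FG xp L c gc c0 A Ap; exact: FG (xp L c gc c0 A Ap). Qed.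

(** Otherwise [F] refines to a filter along which [x] stays in the weakly closed complement of [U],
    which would then contain the limit [p]. *)
Lemma weakly_cvg_weakly_open (I : Type) (F : set_system I) (x : I -> X) p U :
  CAT0 X -> ProperFilter F -> bounded_family x -> weakly_cvg F x p ->
  weakly_open U -> U p -> F (x @^-1` U).
Proof.
move=> HX FF bx xp oU Up; apply: contrapT => FU.
have FP : ProperFilter (within (~` (x @^-1` U)) F) by exact: within_setC_proper.
have xp' : weakly_cvg (within (~` (x @^-1` U)) F) x p.
  by apply: weakly_cvg_sub xp; exact: sub_within.
have nUp : (~` U) p by apply: (weakly_closed_limit HX bx oU xp'); exact: within_self.
exact: nUp Up.
Qed.

End weak_topology_convergence.

(** * Convergence and neighbourhoods for a topology given as data *)

Section topologized.
Context {X : choiceType} (T : topology X).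

Lemma cvg_topologizedP (I : Type) (F : set_system I) (x : I -> X) (p : X) :
  Filter F ->
  (x : I -> topologized T) @ F --> (p : topologized T) <->
  forall U, opens T U -> U p -> F (x @^-1` U).
Proof.
move=> FF; split=> [xp U TU Up|xp A].
  by apply: xp; apply: open_nbhs_nbhs; split.
rewrite nbhsE => -[U [TU Up] UA].
by apply: filterS (xp U TU Up) => i; exact: UA.
Qed.

Lemma nbhs_restrictionP (B : set X) (a : restriction T B) (A : set B) :
  nbhs a A <-> exists U, [/\ opens T U, U (set_val a) & set_val @^-1` U `<=` A].
Proof.
rewrite nbhsE; split=> [[_ [[U TU <-] Ua] UA]|[U [TU Ua UA]]].
  by exists U.
by exists (set_val @^-1` U) => //; split => //; exists U.
Qed.

End topologized.

Lemma tails_proper (X : Type) (x : net X) : ProperFilter (tails x).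
Proof.
apply: filter_from_proper => [|i _]; last by exists i; exact: net_le_refl.
have [i0] := net_inhabited x.
apply: filter_from_filter => [|i j _ _]; first by exists i0.
have [k ik jk] := net_directed i j; exists k => // l /= kl.
by split; [exact: net_le_trans kl|exact: net_le_trans kl].
Qed.

(** * The net associated with a proper filter *)

Section filter_net.
Context {I X : Type} (F : set_system I) (FF : ProperFilter F) (x : I -> X).

Let index := {w : set I * I | F w.1 /\ w.1 w.2}.
(** Only the sets are compared, so the tail from [(U, i)] runs through all points of [U]. *)
Let le (v w : index) := (sval w).1 `<=` (sval v).1.

Program Definition filter_net : net X :=
  @Net X index le (fun w => x (sval w).2) _ _ _ _.
Next Obligation.
have [i _] := filter_ex (@filterT _ F _).
by apply: inhabits; exists (setT, i); split => //; exact: filterT.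
Qed.
Next Obligation. by move=> w. Qed.
Next Obligation. by move=> u v w uv vw i /vw/uv. Qed.
Next Obligation.
move=> [[U i] [/= FU Ui]] [[V j] [/= FV Vj]].
have FUV : F (U `&` V) by exact: filterI.
have [k UVk] := filter_ex FUV.
by exists (exist _ (U `&` V, k) (conj FUV UVk)) => l [].
Qed.

Lemma tails_filter_net (A : set X) :
  tails filter_net (filter_net @^-1` A) <-> F (x @^-1` A).
Proof.
split=> [[[[U i] [/= FU Ui]] _ UA]|FA].
  apply: (filterS _ FU) => j Uj.
  by apply: (UA (exist _ (U, j) (conj FU Uj))) => l.
have [i Ai] := filter_ex FA.
exists (exist _ (x @^-1` A, i) (conj FA Ai)) => // -[[V j] [/= FV Vj]] VA.
exact: VA.
Qed.

End filter_net.

(** * The equivalence of the two conditions *)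

Section weak_topology_on_balls.
Context {R : realType} {X : metricType R} (HX : CAT0 X) (T : topology X).

Definition cvg_iff_weakly := forall (x : net X) (p : X), bounded_family x ->
  (weakly_cvg (tails x) x p <-> net_cvg T x p).

Definition Hausdorff_weak_on_cballs := forall (q : X) (r : R), 0 <= r ->
  hausdorff_space (restriction T (cball q r)) /\
  restriction_opens T (cball q r) =
  restriction_opens (weak_topology X) (cball q r).

(** Carries the condition on nets over to proper filters, to be applied to neighbourhood filters and
    to sequences. *)
Lemma cvg_iff_weakly_filter (I : Type) (F : set_system I) (x : I -> X) p :
  cvg_iff_weakly -> ProperFilter F -> bounded_family x ->
  weakly_cvg F x p <-> forall U, opens T U -> U p -> F (x @^-1` U).
Proof.
move=> HT FF bx.
have bN : bounded_family (filter_net FF x).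
  by have [q [r h]] := bx; exists q, r => w; exact: h.
have TP := tails_proper (filter_net FF x).
have [h1 h2] := HT _ p bN; split=> [xp|xp].
  move=> U TU Up; apply/(tails_filter_net FF).
  have /h1/cvg_topologizedP : weakly_cvg (tails (filter_net FF x)) (filter_net FF x) p.
    move=> L c gc c0 A Ap; apply/(tails_filter_net FF x (Proj (c @` `[0, L]) @^-1` A)).
    exact: xp Ap.
  exact.
move=> L c gc c0 A Ap.
apply/(tails_filter_net FF x (Proj (c @` `[0, L]) @^-1` A)).
suff /h2 h : net_cvg T (filter_net FF x) p by exact: h Ap.
by apply/cvg_topologizedP => U TU Up; apply/tails_filter_net; exact: xp.
Qed.

Lemma cvg_iff_weakly_cballs : cvg_iff_weakly -> Hausdorff_weak_on_cballs.
Proof.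
move=> HT q r r0; set B := cball q r.
have bB (I : Type) (f : I -> B) : bounded_family (set_val \o f).
  by exists q, r => i; exact: (set_valP (f i)).
have val_weak (G : set_system B) (a : B) : ProperFilter G ->
    (forall U, opens T U -> U (set_val a) -> G (set_val @^-1` U)) ->
    weakly_cvg G set_val (set_val a).
  by move=> GP Ga; apply/(cvg_iff_weakly_filter _ HT GP (bB _ id)).
split.
  (* Points that cannot be separated are limits of a common proper filter, hence equal as weak
     limits. *)
  move=> a b; rewrite cluster_cvgE => -[G GP [Gb aG]].
  apply: val_inj; apply: (weakly_cvg_unique HX (F := G) (bB _ id)).
    apply: (val_weak _ _ GP) => U TU Ua; apply: aG.
    by apply/nbhs_restrictionP; exists U; split.
  apply: (val_weak _ _ GP) => U TU Ub; apply: Gb.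
  by apply/nbhs_restrictionP; exists U; split.
apply/seteqP; split => A.
  (* [U] itself need not be weakly open, but the part of the ball outside [U] is weakly closed. *)
  move=> [U TU <-]; exists (~` (~` U `&` B)).
    move=> u p; rewrite setCK => uUB bu up; split.
      move=> Up.
      have [h _] := cvg_iff_weakly_filter p HT eventually_filter bu.
      have /filter_ex[i] := h up U TU Up.
      by case: (uUB i).
    exact: (weakly_cvg_cball HX bu up (fun n => (uUB n).2)).
  apply/seteqP; split => b /=; last by move=> Ub [].
  by move=> h; apply: contrapT => Ub; apply: h; split => //; exact: set_valP.
move=> [V oV <-]; rewrite /restriction_opens.
(* If [V] were no neighbourhood of [b] in the ball, a filter avoiding [V] would converge to [b],
   hence weakly, against weak closedness of the complement of [V]. *)
rewrite openE => b /= Vb; apply: contrapT => nV.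
have FP : ProperFilter (within (~` (set_val @^-1` V)) (nbhs b)).
  exact: within_setC_proper.
have bw : weakly_cvg (within (~` (set_val @^-1` V)) (nbhs b)) set_val (set_val b).
  apply: val_weak => U TU Ub; apply: sub_within.
  by apply/nbhs_restrictionP; exists U; split.
have nVb : (~` V) (set_val b).
  by apply: (weakly_closed_limit HX (bB _ id) oV bw); exact: within_self.
exact: nVb Vb.
Qed.

Lemma cballs_cvg_iff_weakly : Hausdorff_weak_on_cballs -> cvg_iff_weakly.
Proof.
move=> HT x p [q [r0 xr0]].
have TP := tails_proper x; set F := tails x in TP *.
pose r := Num.max r0 (mdist q p).
have r_ge0 : 0 <= r by rewrite le_max mdist_ge0 orbT.
have xB i : cball q r (x i) by rewrite /cball/= le_max xr0.
have pB : cball q r p by rewrite /cball/= le_max lexx orbT.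
have bx : bounded_family x by exists q, r.
have [haus opensE] := HT q r r_ge0.
set B := cball q r in xB pB haus opensE.
have toB z (zB : B z) : {b : B | set_val b = z}.
  by exists (exist _ z (mem_set zB)).
have weak_T (G : set_system (net_index x)) z : ProperFilter G ->
    weakly_cvg G x z -> B z -> forall U, opens T U -> U z -> G (x @^-1` U).
  move=> GP xz zB U TU Uz.
  have [V oV VU] : restriction_opens (weak_topology X) B (set_val @^-1` U).
    by rewrite -opensE; exists U.
  have VUE y : B y -> V y <-> U y.
    move=> yB; have [b <-] := toB y yB.
    by have := congr1 (fun S : set B => S b) VU => /= ->.
  apply: filterS (weakly_cvg_weakly_open HX GP bx xz oV ((VUE z zB).2 Uz)) => i.
  by move/(VUE _ (xB i)).
split=> [xp|/cvg_topologizedP xp].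
  by apply/cvg_topologizedP => U TU Up; exact: weak_T xp pB U TU Up.
move=> L c gc c0 S Sp; apply: contrapT => nS.
pose bad := ~` ((fun i => Proj (c @` `[0, L]) (x i)) @^-1` S).
have GP : ProperFilter (within bad F) by exact: within_setC_proper.
(* The ultrafilter keeps the projections outside [S] yet has a weak limit [y]; once [y = p], the
   projections must enter [S]. *)
have [H [HU GH]] := ultraFilterLemma GP.
have [y xy] := ultra_weakly_cvg HX bx (F := H).
have yB : B y by apply: (weakly_cvg_cball HX bx xy); exact: xB.
suff yp : y = p.
  have HS : H ((fun i => Proj (c @` `[0, L]) (x i)) @^-1` S).
    by rewrite yp in xy; exact: xy Sp.
  have Hbad : H bad by apply: GH; exact: within_self.
  by have [i []] := filter_ex (filterI HS Hbad).
have [a ap] := toB p pB; have [b bE] := toB y yB.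
(* Along [H] the net converges to [p] by hypothesis and to [y] by [weak_T], so neighbourhoods of the
   two points meet. *)
rewrite -ap -bE; congr set_val; apply/esym/haus => A A' /nbhs_restrictionP[U [TU Ua UA]].
move=> /nbhs_restrictionP[V [TV Vb VA']].
rewrite ap in Ua; rewrite bE in Vb.
have h1 : H (x @^-1` U) by apply: GH; apply: sub_within; exact: xp.
have [i [/= Ui Vi]] := filter_ex (filterI h1 (weak_T H y _ xy yB V TV Vb)).
have [w wE] := toB _ (xB i).
by exists w; split; [apply: UA|apply: VA'] => /=; rewrite wE.
Qed.

End weak_topology_on_balls.

Theorem theorem1p4 (R : realType) (X : metricType R) (HX : CAT0 X)
    (T : topology X) :
  (forall (x : net X) (p : X), bounded_family x ->
     (weakly_cvg (tails x) x p <-> net_cvg T x p))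
  <->
  (forall (q : X) (r : R), 0 <= r ->
     hausdorff_space (restriction T (cball q r)) /\
     restriction_opens T (cball q r) =
     restriction_opens (weak_topology X) (cball q r)).
Proof.
split; first exact: cvg_iff_weakly_cballs.
exact: cballs_cvg_iff_weakly.
Qed.
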